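(* If $\mathcal M$ is an edge-transitive map then ${\rm Aut}\,\mathcal M$ contains at most four conjugacy classes of reflections; if it contains exactly four, then $\mathcal M$ is just-edge-transitive.
   Context: All maps (graphs embedded in surfaces; loops and multiple edges allowed) are connected; they may be non-compact, non-orientable, or have boundary. They are described algebraically as follows. Let $\Gamma=\langle R_0,R_1,R_2\mid R_0^2=R_1^2=R_2^2=(R_0R_2)^2=1\rangle$. A map $\mathcal M$ corresponds to a transitive (right) action of $\Gamma$ on a non-empty set $\Phi$, the set of flags (mutually incident vertex-edge-face triples) of $\mathcal M$, where $R_i$ sends each flag $\phi$ to the other flag sharing the same $j$-dimensional components for all $j\neq i$ if there is one, and fixes $\phi$ otherwise; every transitive $\Gamma$-set arises in this way. The vertices, edges and faces of $\mathcal M$ are the orbits on $\Phi$ of $\langle R_1,R_2\rangle$, $\langle R_0,R_2\rangle$ and $\langle R_0,R_1\rangle$ respectively, with incidence given by non-empty intersection. The map subgroups of $\mathcal M$ are the stabilisers $M\le\Gamma$ of flags (a conjugacy class of subgroups). The automorphism group ${\rm Aut}\,\mathcal M$ is the group of permutations of $\Phi$ commuting with the action of $\Gamma$ (it is isomorphic to $N_\Gamma(M)/M$). The map $\mathcal M$ is vertex-, edge- or face-transitive if ${\rm Aut}\,\mathcal M$ acts transitively on its vertices, edges or faces respectively. It is just-edge-transitive if it is edge-transitive but neither vertex-transitive nor face-transitive. A reflection of $\mathcal M$ is an automorphism (necessarily of order $2$) which fixes a point of the surface and acts as a reflection on a disc-shaped neighbourhood of that point; algebraically, it is an automorphism $r\ne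 1$ such that $r(\phi)=\phi R_i$ for some flag $\phi\in\Phi$ and some $i\in\{0,1,2\}$ (equivalently, a non-identity automorphism induced by a conjugate of some $R_i$ lying in $N_\Gamma(M)$). *)

(* Defs.v *)
From HB Require Import structures.
From mathcomp Require Import all_boot.
From mathcomp Require Import boolp classical_sets functions cardinality.

Set Implicit Arguments.
Unset Strict Implicit.
Unset Printing Implicit Defensive.

Local Open Scope classical_set_scope.

(* A map is a transitive right action of
   Gamma = < R_0, R_1, R_2 | R_0^2 = R_1^2 = R_2^2 = (R_0 R_2)^2 = 1 >
   on a non-empty, possibly infinite, set of flags.  Such an action is the same
   thing as three functions satisfying the relators.  The generators being
   involutions, every element of Gamma is a positive word in them; the word
   [:: i1; ...; ik] stands for R_i1 ... R_ik. *)
Definition act_word (T : Type) (R : 'I_3 -> T -> T) (x : T) (w : seq 'I_3) : T :=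
  foldl (fun y i => R i y) x w.

Record flag_map := FlagMap {
  flag :> Type;
  flagR : 'I_3 -> flag -> flag;
  flag_nonempty : inhabited flag;
  flagR_sq : forall (i : 'I_3) (x : flag), act_word flagR x [:: i; i] = x;
  flagR02_sq : forall x : flag,
    act_word flagR x [:: ord0; ord_max; ord0; ord_max] = x;
  flag_transitive : forall x y : flag, exists w : seq 'I_3, act_word flagR x w = y
}.

(* The cell of dimension j through x: the orbit of x under < R_i | i != j >. *)
Definition cell (M : flag_map) (j : 'I_3) (x : M) : set M :=
  [set act_word (@flagR M) x w | w in [set w : seq 'I_3 | all (predC1 j) w]].

Definition cells (M : flag_map) (j : 'I_3) : set (set M) := range (@cell M j).
Arguments cells : clear implicits.

Definition vertices (M : flag_map) : set (set M) := cells M (@Ordinal 3 0 isT).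
Definition edges (M : flag_map) : set (set M) := cells M (@Ordinal 3 1 isT).
Definition faces (M : flag_map) : set (set M) := cells M (@Ordinal 3 2 isT).
Arguments vertices : clear implicits.
Arguments edges : clear implicits.
Arguments faces : clear implicits.

Record Aut (M : flag_map) := MkAut {
  aut_fun :> M -> M;
  aut_bij : bijective aut_fun;
  aut_comm : forall (i : 'I_3) (x : M), aut_fun (flagR i x) = flagR i (aut_fun x)
}.

Section AutGroup.
Variable M : flag_map.
Implicit Types f g : Aut M.

Lemma aut_ext f g : (forall x, f x = g x) -> f = g.
Proof.
case: f g => f bf cf [g bg cg] /= /funext fg; subst g.
by congr MkAut; apply: Prop_irrelevance.
Qed.

Definition aut_one : Aut M := MkAut (@inv_bij M id (fun=> erefl)) (fun _ _ => erefl).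

Lemma aut_mul_comm f g (i : 'I_3) (x : M) :
  (f \o g) (flagR i x) = flagR i ((f \o g) x).
Proof. by rewrite /= !aut_comm. Qed.

Definition aut_mul f g : Aut M :=
  MkAut (bij_comp (aut_bij f) (aut_bij g)) (@aut_mul_comm f g).

Lemma aut_inv_exists f : exists g, cancel f g /\ cancel g f.
Proof.
have [h fh hf] := aut_bij f.
have hR (i : 'I_3) (x : M) : h (flagR i x) = flagR i (h x).
  by rewrite -{1}(hf x) -aut_comm fh.
by exists (MkAut (Bijective hf fh) hR).
Qed.

Definition aut_inv f : Aut M := sval (cid (aut_inv_exists f)).

Lemma aut_invP f : cancel f (aut_inv f) /\ cancel (aut_inv f) f.
Proof. exact: (svalP (cid (aut_inv_exists f))). Qed.

Lemma aut_mulA : associative aut_mul.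
Proof. by move=> f g h; apply: aut_ext. Qed.
Lemma aut_mul1 : left_id aut_one aut_mul.
Proof. by move=> f; apply: aut_ext. Qed.
Lemma aut_mulr1 : right_id aut_one aut_mul.
Proof. by move=> f; apply: aut_ext. Qed.
Lemma aut_mulV : left_inverse aut_one aut_inv aut_mul.
Proof. by move=> f; apply: aut_ext => x /=; case: (aut_invP f). Qed.
Lemma aut_mulrV : right_inverse aut_one aut_inv aut_mul.
Proof. by move=> f; apply: aut_ext => x /=; case: (aut_invP f). Qed.

HB.instance Definition _ := gen_eqMixin (Aut M).
HB.instance Definition _ := gen_choiceMixin (Aut M).
HB.instance Definition _ := isGroup.Build (Aut M)
  aut_mulA aut_mul1 aut_mulr1 aut_mulV aut_mulrV.

End AutGroup.

Definition transitive_on (M : flag_map) (C : set (set M)) : Prop :=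
  forall c d : set M, C c -> C d -> exists f : Aut M, f @` c = d.

Definition vertex_transitive (M : flag_map) : Prop := transitive_on (vertices M).
Definition edge_transitive (M : flag_map) : Prop := transitive_on (edges M).
Definition face_transitive (M : flag_map) : Prop := transitive_on (faces M).

Definition just_edge_transitive (M : flag_map) : Prop :=
  edge_transitive M /\ ~ vertex_transitive M /\ ~ face_transitive M.

Definition is_reflection (M : flag_map) (r : Aut M) : Prop :=
  r <> 1%g /\ exists (x : M) (i : 'I_3), r x = flagR i x.

Definition conj_class (G : groupType) (x : G) : set G :=
  [set conjg x g | g in [set: G]].

Definition reflection_classes (M : flag_map) : set (set (Aut M)) :=
  [set conj_class r | r in [set r : Aut M | is_reflection r]].
Arguments reflection_classes : clear implicits.

(* Main.v *)
Require Import Defs.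
From mathcomp Require Import all_boot.
From mathcomp Require Import boolp classical_sets functions cardinality.

Set Implicit Arguments.
Unset Strict Implicit.

Local Open Scope classical_set_scope.
Local Open Scope card_scope.

(** The automorphism group acts semiregularly on flags, so a reflection [r] is
    determined by one flag [y] and the index [i] with [r y = R_i y]; its
    conjugacy class then depends only on [i] and on the orbit of [y] under
    automorphisms ([conj_class_reflecting], [reflecting_orbit]).

    If the map is edge-transitive, [y] may be moved into the edge of a chosen
    flag [x], which consists of [x], [R0 x], [R2 x] and [R0 R2 x].  As [R0] and
    [R2] commute, all four flags define the same reflection when [i = 0], and
    likewise when [i = 2].  So there are six candidate classes: one for
    [i = 0], one for [i = 2], and one for [i = 1] at each of the four flags.
    They cannot coexist: a reflection with [i = 0] (or [i = 2]) carries [x] to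
    [R0 x] (or [R2 x]) and hence identifies the four candidates for [i = 1] in
    pairs.  The outcome ([few_reflection_classes]) is that there are at most
    three classes as soon as some automorphism (the identity, if flags coincide)
    carries [x] to [R0 x], [R2 x] or [R0 R2 x]; otherwise only the four
    candidates with [i = 1] remain.

    Four classes therefore force the four flags of an edge into distinct
    orbits, while a reflection with [i = 1] exists at each of them, so that
    [R1] preserves every orbit.  The flags around the vertex of [x] then lie in
    the orbits of [x] and [R2 x] only, and those around the vertex of [R0 x] in
    the other two, so no automorphism carries one vertex to the other; exchange
    [R0] and [R2] for faces ([cell_transitive_same_orbit]). *)

Notation i0 := (@ord0 2).
Notation i1 := (@Ordinal 3 1 isT).
Notation i2 := (@ord_max 2).

Lemma ord3_cases (i : 'I_3) : [\/ i = i0, i = i1 | i = i2].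
Proof.
by case: i => [[|[|[|//]]] p];
  [apply: Or31|apply: Or32|apply: Or33]; apply: val_inj.
Qed.

Section Flags.
Variable M : flag_map.
Implicit Types (x y z : M) (f g r : Aut M) (i j k : 'I_3).

Local Notation R := (@flagR M).

Lemma flagRK i : involutive (R i).
Proof. exact: (@flagR_sq M i). Qed.

Lemma flagR02C y : R i0 (R i2 y) = R i2 (R i0 y).
Proof. by rewrite -{1}(flagR02_sq y) /act_word /= !flagRK. Qed.

Lemma flagR_comm i j y : i <> i1 -> j <> i1 -> R i (R j y) = R j (R i y).
Proof.
by case: (ord3_cases i) => ->; case: (ord3_cases j) => -> // _ _;
  rewrite flagR02C.
Qed.

Lemma aut_act_word f y w : f (act_word R y w) = act_word R (f y) w.
Proof. by elim: w y => //= i w IH y; rewrite IH aut_comm. Qed.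

Lemma aut_semiregular f g y : f y = g y -> f = g.
Proof.
move=> fg; apply: aut_ext => z; have [w <-] := flag_transitive y z.
by rewrite !aut_act_word fg.
Qed.

Lemma cell_closed (P : M -> Prop) j x :
  P x -> (forall i y, i <> j -> P y -> P (R i y)) ->
  forall y, cell j x y -> P y.
Proof.
move=> Px PR _ [w jw <-]; elim: w x Px jw => //= i w IH x Px /andP[/eqP ij jw].
by apply: IH => //; apply: PR.
Qed.

Lemma cell_refl j x : cell j x x.
Proof. by exists [::]. Qed.

Definition same_orbit y z := exists f : Aut M, f y = z.

Lemma same_orbit_refl y : same_orbit y y.
Proof. by exists 1%g. Qed.

Lemma same_orbit_sym {y z} : same_orbit y z -> same_orbit z y.
Proof. by case=> f <-; exists (aut_inv f); apply: (aut_invP f).1. Qed.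

Lemma same_orbit_trans {y x z} :
  same_orbit x y -> same_orbit y z -> same_orbit x z.
Proof. by move=> [f <-] [g <-]; exists (aut_mul g f). Qed.

Lemma same_orbitR i {y z} : same_orbit y z -> same_orbit (R i y) (R i z).
Proof. by case=> f <-; exists f; rewrite aut_comm. Qed.

(** Once it is non-empty, this is the conjugacy class of the automorphism that
    sends [y] to [R i y]; being defined in any case, it lets the candidate
    classes be listed before it is known which of them occur. *)
Definition reflecting y i : set (Aut M) :=
  [set s | exists z, same_orbit y z /\ s z = R i z].

Lemma reflecting_orbit y z i :
  same_orbit y z -> reflecting y i = reflecting z i.
Proof.
move=> yz; apply/seteqP; split=> s [t [yt st]]; exists t; split=> //.
  exact: same_orbit_trans (same_orbit_sym yz) yt.
exact: same_orbit_trans yz yt.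
Qed.

(** Conjugating [r] by [g] moves the flag [y] to its image under [g^-1], and
    semiregularity makes every [s] on the right-hand side such a conjugate. *)
Lemma conj_class_reflecting r y i :
  r y = R i y -> conj_class r = reflecting y i.
Proof.
move=> ry; apply/seteqP; split=> [_ [g _ <-]|s [z [[f <-] sz]]].
  exists (aut_inv g y); split; first by exists (aut_inv g).
  change (aut_inv g (r (g (aut_inv g y))) = R i (aut_inv g y)).
  by rewrite (aut_invP g).2 ry aut_comm.
exists (aut_inv f) => //; apply: (@aut_semiregular _ _ (f y)); rewrite sz.
change (aut_inv (aut_inv f) (r (aut_inv f (f y))) = R i (f y)).
rewrite (aut_invP f).1 ry -aut_comm -[y in LHS](aut_invP f).1 -aut_comm.
by rewrite (aut_invP (aut_inv f)).1 aut_comm.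
Qed.

Lemma reflection_classes_same_orbit y i :
  reflection_classes M (reflecting y i) -> same_orbit y (R i y).
Proof.
case=> r _ rE; have : conj_class r r.
  by exists 1%g => //; exact: conjg1.
rewrite rE => -[z [[f <-] rz]]; exists (aut_mul (aut_inv f) (aut_mul r f)) => /=.
by rewrite rz -aut_comm (aut_invP f).1.
Qed.

(** The classes with index 0 or 2 do not depend on the flag of the edge. *)
Lemma reflecting_edge r y i j :
  i <> i1 -> j <> i1 -> r y = R i y -> r (R j y) = R i (R j y).
Proof. by move=> i1' j1' ry; rewrite aut_comm ry flagR_comm. Qed.

Definition in_edge x y :=
  [\/ y = x, y = R i0 x, y = R i2 x | y = R i0 (R i2 x)].

Lemma cell1_in_edge x y : cell i1 x y -> in_edge x y.
Proof.
apply: cell_closed => [|i z]; first exact: Or41.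
case: (ord3_cases i) => -> // _ [] ->; rewrite -?flagR02C ?flagRK.
all: by [exact: Or41|exact: Or42|exact: Or43|exact: Or44].
Qed.

Section EdgeTransitive.
Hypothesis hM : edge_transitive M.

Lemma edge_transitive_orbit x y :
  exists z, in_edge x z /\ same_orbit z y.
Proof.
have [||f fE] := @hM (cell i1 x) (cell i1 y).
- by exists x.
- by exists y.
have := cell_refl i1 y; rewrite -fE => -[z xz fz].
by exists z; split; [exact: cell1_in_edge|exists f].
Qed.

Lemma reflection_classes_cover x C : reflection_classes M C ->
  [\/ C = reflecting x i0 /\ same_orbit x (R i0 x),
      C = reflecting x i2 /\ same_orbit x (R i2 x) |
      exists z, in_edge x z /\ C = reflecting z i1].
Proof.
case=> r rP CE; have [_ [y [i ry]]] := rP; have [z [xz zy]] := edge_transitive_orbit x y.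
have CzE : C = reflecting z i.
  by rewrite -CE (reflecting_orbit _ zy); apply: conj_class_reflecting.
have [i1E|ni1] := pselect (i = i1).
  by apply: Or33; exists z; rewrite CzE i1E.
have [s sz] : same_orbit z (R i z).
  by apply: reflection_classes_same_orbit; rewrite -CzE -CE; exists r.
have sx : s x = R i x.
  have sR j u : j <> i1 -> s (R j u) = R i (R j u) -> s u = R i u.
    by move=> nj1 /(reflecting_edge ni1 nj1); rewrite flagRK.
  by case: xz sz => -> // sz; [exact: (sR i0)|exact: (sR i2)|apply: (sR i2) => //; exact: (sR i0)].
have CxE : C = reflecting x i.
  by rewrite CzE -(conj_class_reflecting sz) (conj_class_reflecting sx).
by case: (ord3_cases i) ni1 CxE sx => -> // _ CxE sx; [apply: Or31|apply: Or32];
   split=> //; exists s.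
Qed.

(** A pair of orbits among the flags of the edge is merged as soon as one
    automorphism carries [x] to another flag of its edge, since [R0] and [R2]
    commute with automorphisms; this leaves at most two candidates with index 1,
    and only one if [x] is carried both to [R0 x] and to [R2 x].  The candidate
    with index 0 needs [x] to be carried to [R0 x], and the one with index 2
    needs [R2 x], so no combination leaves more than three. *)
Lemma few_reflection_classes x :
  (exists F : nat -> set (Aut M), reflection_classes M `<=` F @` `I_3) \/
  [/\ ~ same_orbit x (R i0 x), ~ same_orbit x (R i2 x),
      ~ same_orbit x (R i0 (R i2 x)) &
      reflection_classes M `<=` [set reflecting z i1 | z in in_edge x]].
Proof.
have cover := @reflection_classes_cover x.
have E y z (yz : same_orbit y z) := reflecting_orbit i1 yz.
pose F := nth (set0 : set (Aut M)).
have [x0|nx0] := pselect (same_orbit x (R i0 x)).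
  have /E E02 : same_orbit (R i2 x) (R i0 (R i2 x)).
    by rewrite flagR02C; apply: same_orbitR.
  move/E: x0 => E0; left; have [x2|nx2] := pselect (same_orbit x (R i2 x)).
    move/E: x2 => E2.
    exists (F [:: reflecting x i0; reflecting x i2; reflecting x i1]) => C.
    move/cover => [[-> _]|[-> _]|[z [xz ->]]];
      [by exists 0|by exists 1|exists 2 => //=].
    by case: xz => ->; rewrite -?E02 -?E2 -?E0.
  exists (F [:: reflecting x i0; reflecting x i1; reflecting (R i2 x) i1]) => C.
  move/cover => [[-> _]|[_ /nx2]//|[z [xz ->]]]; first by exists 0.
  by case: xz => ->; rewrite -?E02 -?E0; [exists 1|exists 1|exists 2|exists 2].
have [x2|nx2] := pselect (same_orbit x (R i2 x)).
  have /E E02 := same_orbitR i0 x2; move/E: x2 => E2; left.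
  exists (F [:: reflecting x i2; reflecting x i1; reflecting (R i0 x) i1]) => C.
  move/cover => [[_ /nx0]//|[-> _]|[z [xz ->]]]; first by exists 0.
  by case: xz => ->; rewrite -?E02 -?E2; [exists 1|exists 2|exists 1|exists 2].
have [x02|nx02] := pselect (same_orbit x (R i0 (R i2 x))).
  have /E : same_orbit (R i0 x) (R i2 x).
    by rewrite -[R i2 x](flagRK i0); apply: same_orbitR.
  move/E: x02 => E02 E2; left.
  exists (F [:: reflecting x i1; reflecting (R i0 x) i1]) => C.
  move/cover => [[_ /nx0]//|[_ /nx2]//|[z [xz ->]]].
  by case: xz => ->; rewrite -?E02 -?E2; [exists 0|exists 1|exists 1|exists 0].
right; split=> // C /cover[[_ /nx0]//|[_ /nx2]//|[z [xz ->]]].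
by exists z.
Qed.

(** Every flag lies in the orbit of a flag of the edge of [x], and [R1] commutes
    with automorphisms. *)
Lemma same_orbitR1 x :
  (forall z, in_edge x z -> same_orbit z (R i1 z)) ->
  forall y, same_orbit y (R i1 y).
Proof.
move=> xR1 y; have [z [xz zy]] := edge_transitive_orbit x y.
exact: same_orbit_trans (same_orbit_sym zy)
  (same_orbit_trans (xR1 _ xz) (same_orbitR _ zy)).
Qed.

End EdgeTransitive.

(** Used with [j = 0] and [k = 2] for vertices, [j = 2] and [k = 0] for faces.  If
    [R1] preserves orbits, walking around a [j]-cell with [R1] and [R k] meets
    only the orbits of [x] and [R k x]; an automorphism onto the next cell puts
    [R j x] into one of them. *)
Lemma cell_transitive_same_orbit j k x :
  (forall i, i <> j -> i = i1 \/ i = k) ->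
  (forall y, same_orbit y (R i1 y)) -> transitive_on (cells M j) ->
  same_orbit x (R j x) \/ same_orbit (R k x) (R j x).
Proof.
move=> jk orbR1 trans.
have [||f fE] := @trans (cell j x) (cell j (R j x)).
- by exists x.
- by exists (R j x).
have := cell_refl j (R j x); rewrite -fE => -[w + fw].
have wjx : same_orbit w (R j x) by exists f.
suff orb_cell y : cell j x y -> same_orbit x y \/ same_orbit (R k x) y.
  by move/orb_cell => [?|?]; [left|right]; apply: same_orbit_trans wjx.
move: y; apply: cell_closed => [|i y /jk[->|->] [xy|xy]].
- by left; apply: same_orbit_refl.
- by left; apply: same_orbit_trans (orbR1 y).
- by right; apply: same_orbit_trans (orbR1 y).
- by right; apply: same_orbitR.
- by left; rewrite -[x](flagRK k); apply: same_orbitR.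
Qed.

End Flags.

(** A set with [n + 1] elements that is covered by [n + 1] values takes all of
    them: leaving out the value at [i] covers it by the [n] values at the
    indices [bump i j]. *)
Lemma card_eq_cover (T : Type) (A : set T) (F : nat -> T) n :
  A `<=` F @` `I_n.+1 -> A #= `I_n.+1 -> forall i, (i <= n)%N -> A (F i).
Proof.
move=> AF An i lein; apply: contrapT => nAi.
have : `I_n.+1 #<= `I_n.
  rewrite -(card_le_eql An).
  apply: (@card_le_trans _ _ _ ((F \o bump i) @` `I_n)); last exact: card_image_le.
  apply: subset_card_le => a Aa; have [j /= ltj Fj] := AF _ Aa.
  have neq : j != i by apply/eqP => ji; apply: nAi; rewrite -ji Fj.
  exists (unbump i j); last by rewrite /= unbumpK // inE.
  rewrite /= /unbump; case: (ltngtP i j) neq => // [ij|ji] _ /=.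
    by rewrite subn1 prednK //; apply: leq_ltn_trans ij.
  by rewrite subn0; apply: leq_trans ji lein.
by rewrite card_le_II ltnn.
Qed.

Theorem theorem1p3 (M : flag_map) (hM : edge_transitive M) :
  reflection_classes M #<= `I_4 /\
  (reflection_classes M #= `I_4 -> just_edge_transitive M).
Proof.
have [x] := flag_nonempty M.
have [[F AF]|[nx0 nx2 nx02 AE]] := few_reflection_classes hM x.
  have A3 : reflection_classes M #<= `I_3.
    exact: card_le_trans (subset_card_le AF) (card_image_le _ _).
  split=> [|/card_eqPle[_ A4]]; first by apply: card_le_trans A3 _; rewrite card_le_II.
  by have := card_le_trans A4 A3; rewrite card_le_II.
pose flags := [:: x; flagR i0 x; flagR i2 x; flagR i0 (flagR i2 x)].
pose F n := reflecting (nth x flags n) i1.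
have AF : reflection_classes M `<=` F @` `I_4.
  by move=> C /AE[z + <-] => -[] ->; [exists 0|exists 1|exists 2|exists 3].
split=> [|A4]; first exact: card_le_trans (subset_card_le AF) (card_image_le _ _).
have R1 : forall y : M, same_orbit y (flagR i1 y).
  apply: (same_orbitR1 hM (x := x)) => z xz.
  have AFn := card_eq_cover AF A4.
  apply: reflection_classes_same_orbit.
  by case: xz => ->; [exact: (AFn 0)|exact: (AFn 1)|exact: (AFn 2)|exact: (AFn 3)].
split=> //; split=> trans.
  have [i||] := cell_transitive_same_orbit (j := i0) (k := i2) x _ R1 trans.
  - by case: (ord3_cases i) => ->; [|left|right].
  - exact: nx0.
  - move/(same_orbitR i2); rewrite flagRK -flagR02C; exact: nx02.
have [i||] := cell_transitive_same_orbit (j := i2) (k := i0) x _ R1 trans.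
- by case: (ord3_cases i) => ->; [right|left|].
- exact: nx2.
- move/(same_orbitR i0); rewrite flagRK; exact: nx02.
Qed.
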